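(* The antipode of the ripping and sewing Hopf monoid of simple graphs $\mathbf W$ is given by the following cancellation-free expression. If $w$ is a simple graph on $I$ then $$\mathsf s_I(w)=\sum_{t\text{ tubing of }w}(-1)^{|t|}\,w(t),$$ where $|t|$ is the number of tubes of $t$ and $w(t)=\bigsqcup_{\tau\text{ tube of }t}w[t_{<\tau},\tau]$.
   Context: $\mathrm W[I]$ is the set of simple graphs (no loops, half-edges, or multiple edges) on the finite vertex set $I$; $\mathbf W[I]$ is the vector space with basis $\mathrm W[I]$ over a field of characteristic $0$. For an ordered decomposition $I=S\sqcup T$, the product of $w_1\in\mathrm W[S]$ and $w_2\in\mathrm W[T]$ is their disjoint union, and the coproduct is $\Delta_{S,T}(w)=w|_S\otimes w/_S$, where $w|_S$ is the induced subgraph on $S$, and $w/_S$ is the simple graph on $T$ with an edge $uv$ (for distinct $u,v\in T$) whenever $w$ contains a path from $u$ to $v$ all of whose intermediate vertices (if any) are in $S$. These make $\mathbf W$ a connected Hopf monoid. With $\mu_{S_1,\dots,S_k},\Delta_{S_1,\dots,S_k}$ the iterated (co)products, the antipode is $\mathsf s_\emptyset=\mathrm{id}$ and, for $I\neq\emptyset$, $\mathsf s_I=\sum(-1)^k\mu_{S_1,\dots,S_k}\circ\Delta_{S_1,\dots,S_k}$, over all $k\ge1$ and ordered sequences of nonempty pairwise disjoint $S_1,\dots,S_k$ with union $I$. A tube of $w$ is a nonempty subset $J\subseteq I$ such that the induced subgraph of $w$ on $J$ is connected. A tubing of $w$ is a set $t$ of tubes such that: any two tubes in $t$ are disjoint or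 nested; if $\tau_1,\dots,\tau_k$ ($k\ge2$) are pairwise disjoint tubes in $t$, then $\tau_1\cup\cdots\cup\tau_k$ is not a tube of $w$; and every connected component of $w$ is a tube in $t$. For a tube $\tau\in t$, $t_{<\tau}$ is the union of the tubes of $t$ strictly contained in $\tau$; the sets $\tau-t_{<\tau}$ partition $I$. The graph $w[t_{<\tau},\tau]:=(w|_\tau)/_{t_{<\tau}}$ is a simple graph on $\tau-t_{<\tau}$, so $w(t)$ is a simple graph on $I$. An expression $\sum_\alpha c_\alpha x_\alpha$ in basis elements is cancellation-free if no $\alpha\ne\beta$ have $x_\alpha=x_\beta$ with $c_\alpha,c_\beta$ of opposite sign. *)

(* Defs.v *)
From HB Require Import structures.
From mathcomp Require Import all_boot all_order all_algebra.

Set Implicit Arguments.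
Unset Strict Implicit.
Unset Printing Implicit Defensive.

Import Order.TTheory GRing.Theory Num.Theory.
Local Open Scope ring_scope.

(* Finite vertex sets are the subsets I of an arbitrary ambient finType V. *)

Section SimpleGraphs.

Variable V : finType.

Definition is_edge_set (I : {set V}) (E : {set {set V}}) : bool :=
  [forall e in E, (e \subset I) && (#|e| == 2%N)].

Record sgraph (I : {set V}) : Type := SGraph {
  edges : {set {set V}};
  _ : is_edge_set I edges
}.

HB.instance Definition _ (I : {set V}) := [isSub for @edges I].
HB.instance Definition _ (I : {set V}) := [Finite of sgraph I by <:].

Definition adj (I : {set V}) (w : sgraph I) : rel V :=
  [rel u v | [set u; v] \in edges w].

Definition edges_of (I : {set V}) (r : rel V) : {set {set V}} :=
  [set e : {set V} | [exists u in I, exists v in I,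
     [&& u != v, r u v & e == [set u; v]]]].

Lemma edges_ofP (I : {set V}) (r : rel V) : is_edge_set I (edges_of I r).
Proof.
apply/forall_inP => e; rewrite inE => /exists_inP[u Iu /exists_inP[v Iv]].
case/and3P=> ne_uv _ /eqP->; rewrite cards2 ne_uv andbT.
by apply/subsetP => x; rewrite !inE => /orP[] /eqP->.
Qed.

(* The simple graph on I with an edge uv, for distinct u, v in I, whenever
   r u v or r v u. *)
Definition mk_sgraph (I : {set V}) (r : rel V) : sgraph I :=
  SGraph (edges_ofP I r).

Lemma adj_sym (I : {set V}) (w : sgraph I) : symmetric (adj w).
Proof. by move=> u v; rewrite /adj /= setUC. Qed.

Lemma adj_mk (I : {set V}) (r : rel V) (u v : V) :
  adj (mk_sgraph I r) u v = [&& u \in I, v \in I, u != v & r u v || r v u].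
Proof.
rewrite /adj /= inE; apply/idP/idP.
  case/exists_inP=> x Ix /exists_inP[y Iy /and3P[ne_xy rxy /eqP/setP eq_e]].
  have := eq_e u; have := eq_e v; have := eq_e x; have := eq_e y.
  rewrite !inE !eqxx ?orbT /=.
  do 2![move/orP=> [] /eqP ?; subst]; rewrite ?eqxx ?orbT //= in ne_xy *.
  - by move: ne_xy; rewrite eq_sym => ->; rewrite Ix Iy rxy orbT.
  - by rewrite Ix Iy ne_xy rxy.
case/and4P=> Iu Iv ne_uv /orP[] ruv.
  by apply/exists_inP; exists u => //; apply/exists_inP; exists v; rewrite ?ne_uv ?ruv /=.
apply/exists_inP; exists v => //; apply/exists_inP; exists u => //.
by rewrite eq_sym ne_uv ruv setUC /=.
Qed.

(* w|_S, used for S \subset I *)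
Definition restr (I S : {set V}) (w : sgraph I) : sgraph S :=
  mk_sgraph S (adj w).

(* a path (with distinct vertices) from u to v, where p lists its
   intermediate vertices; there are fewer than #|V| of them *)
Definition path_through (I : {set V}) (w : sgraph I) (S : {set V}) : rel V :=
  [rel u v | [exists n : 'I_#|V|, [exists p : n.-tuple V,
     [&& uniq (u :: rcons p v), path (adj w) u (rcons p v)
       & all [in S] p]]]].

(* w/_S as a graph on T; used when the vertex set I of w is S \sqcup T *)
Definition rip (I S T : {set V}) (w : sgraph I) : sgraph T :=
  mk_sgraph T (path_through w S).

Definition dunion (S T : {set V}) (w1 : sgraph S) (w2 : sgraph T) :
    sgraph (S :|: T) :=
  mk_sgraph (S :|: T) [rel u v | adj w1 u v || adj w2 u v].

Definition empty_graph : sgraph set0 := mk_sgraph set0 [rel _ _ | false].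

Definition connected_graph (I : {set V}) (w : sgraph I) : bool :=
  [forall u in I, forall v in I, connect (adj w) u v].

Definition components (I : {set V}) (w : sgraph I) : {set {set V}} :=
  [set [set y in I | connect (adj w) x y] | x in I].

Definition tube (I : {set V}) (w : sgraph I) (J : {set V}) : bool :=
  [&& J != set0, J \subset I & connected_graph (restr J w)].

Definition tubing (I : {set V}) (w : sgraph I) (t : {set {set V}}) : bool :=
  [&& [forall J in t, tube w J],
      [forall J1 in t, forall J2 in t,
         [|| [disjoint J1 & J2], J1 \subset J2 | J2 \subset J1]],
      [forall X : {set {set V}},
         [&& X \subset t, (2 <= #|X|)%N & trivIset X] ==> ~~ tube w (cover X)]
    & components w \subset t].

Definition below (t : {set {set V}}) (J : {set V}) : {set V} :=
  \bigcup_(A in t | A \proper J) A.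

(* w[t_{<J}, J] = (w|_J)/_{t_{<J}} *)
Definition tube_graph (I : {set V}) (w : sgraph I) (t : {set {set V}})
    (J : {set V}) : sgraph (J :\: below t J) :=
  rip (below t J) (J :\: below t J) (restr J w).

(* w(t), the union of the graphs w[t_{<J}, J] for J in t *)
Definition tubing_graph (I : {set V}) (w : sgraph I) (t : {set {set V}}) :
    sgraph I :=
  mk_sgraph I [rel u v | [exists J in t, adj (tube_graph w t J) u v]].

(* union of a sequence of sets, and the canonical basis of the tensor product
   W[S_1] \otimes ... \otimes W[S_k]; the clauses for one set make the unary
   (co)products literally identities *)
Fixpoint cupseq (s : seq {set V}) : {set V} :=
  match s with
  | [::] => set0
  | A :: s' => match s' with [::] => A | _ :: _ => A :|: cupseq s' end
  end.

Fixpoint graphs (s : seq {set V}) : finType :=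
  match s with
  | [::] => unit
  | A :: s' => match s' with
               | [::] => sgraph A
               | _ :: _ => (sgraph A * graphs s')%type
               end
  end.

Definition is_composition (I : {set V}) (s : seq {set V}) : bool :=
  [&& all (fun S => S != set0) s,
      pairwise (fun S T : {set V} => [disjoint S & T]) s
    & cupseq s == I].

Record composition (I : {set V}) (k : nat) : Type := Composition {
  blocks :> k.-tuple {set V};
  _ : is_composition I blocks
}.

HB.instance Definition _ (I : {set V}) (k : nat) := [isSub for @blocks I k].
HB.instance Definition _ (I : {set V}) (k : nat) :=
  [Finite of composition I k by <:].

Lemma cupseq_composition (I : {set V}) (k : nat) (c : composition I k) :
  cupseq c = I.
Proof. by case: c => s /= /and3P[_ _ /eqP]. Qed.

End SimpleGraphs.

Section FreeModules.

Variable K : fieldType.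

Definition free_on (A : finType) : Type := {ffun A -> K^o}.

Definition basis_vec (A : finType) (a : A) : free_on A :=
  [ffun b => (a == b)%:R].

Definition lin_ext (A B : finType) (f : A -> free_on B) (x : free_on A) :
    free_on B :=
  \sum_(a : A) x a *: f a.

(* free_on (A * B) is the tensor product of free_on A and free_on B *)
Definition tensor (A B : finType) (x : free_on A) (y : free_on B) :
    free_on (A * B)%type :=
  [ffun p => x p.1 * y p.2].

Definition tensor_map (A B C D : finType)
    (f : free_on A -> free_on C) (g : free_on B -> free_on D) :
    free_on (A * B)%type -> free_on (C * D)%type :=
  lin_ext (fun p => tensor (f (basis_vec p.1)) (g (basis_vec p.2))).

End FreeModules.

Section RippingAndSewing.

Variables (K : fieldType) (V : finType).

Definition W (I : {set V}) : Type := free_on K (sgraph I).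

Definition prodW (S T : {set V}) :
    free_on K (sgraph S * sgraph T)%type -> W (S :|: T) :=
  lin_ext (fun p => basis_vec K (dunion p.1 p.2)).

Definition coprodW (S T : {set V}) :
    W (S :|: T) -> free_on K (sgraph S * sgraph T)%type :=
  lin_ext (fun w => tensor (basis_vec K (restr S w)) (basis_vec K (rip S T w))).

Fixpoint iprodW (s : seq {set V}) : free_on K (graphs s) -> W (cupseq s) :=
  match s return free_on K (graphs s) -> W (cupseq s) with
  | [::] => lin_ext (fun _ => basis_vec K (empty_graph V))
  | A :: s' =>
    match s' return (free_on K (graphs s') -> W (cupseq s')) ->
                    free_on K (graphs (A :: s')) -> W (cupseq (A :: s')) with
    | [::] => fun _ => id
    | _ :: _ => fun m x =>
        prodW (tensor_map (id : W A -> W A) m x)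
    end (@iprodW s')
  end.

Fixpoint icoprodW (s : seq {set V}) : W (cupseq s) -> free_on K (graphs s) :=
  match s return W (cupseq s) -> free_on K (graphs s) with
  | [::] => lin_ext (fun _ => basis_vec K tt)
  | A :: s' =>
    match s' return (W (cupseq s') -> free_on K (graphs s')) ->
                    W (cupseq (A :: s')) -> free_on K (graphs (A :: s')) with
    | [::] => fun _ => id
    | _ :: _ => fun d x =>
        tensor_map (id : W A -> W A) d (coprodW x)
    end (@icoprodW s')
  end.

Definition castW (I J : {set V}) (eqIJ : I = J) (x : W I) : W J :=
  ecast X (W X) eqIJ x.

(* A composition of I has at most #|I| blocks, so the sum ranges over all
   compositions of positive length. *)
Definition antipode (I : {set V}) (x : W I) : W I :=
  if I == set0 then x
  else \sum_(1 <= k < #|I|.+1) \sum_(c : composition I k)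
         (-1) ^+ k *: castW (cupseq_composition c)
           (iprodW (icoprodW (castW (esym (cupseq_composition c)) x))).

End RippingAndSewing.

(* The expression \sum_(a | P a) c a *: x a; "opposite sign" is read in int,
   as the ground field is not ordered. *)
Definition cancellation_free (A : finType) (X : eqType) (P : pred A)
    (c : A -> int) (x : A -> X) : Prop :=
  forall a b : A, P a -> P b -> a <> b -> x a = x b -> ~ (c a * c b < 0).

(* Main.v *)
Require Import Defs.
From mathcomp Require Import all_boot all_order all_algebra.

Set Implicit Arguments.
Unset Strict Implicit.
Unset Printing Implicit Defensive.

Import Order.TTheory GRing.Theory Num.Theory.
Local Open Scope ring_scope.

(** The antipode is an alternating sum over compositions (S_1, ..., S_k) of
    the vertex set I.  Two vertices of S_i are adjacent in the graph of such a
    term when [w] has a path between them whose intermediate vertices lie in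
    S_1, ..., S_(i-1) ([antipode_term]); this holds because ripping out [P] and
    then [A] is ripping out their union ([path_through_rip]).  Hence the last
    block contributes exactly the edges of the ripped graph w/_Y, where Y is
    the union of the other blocks, and the sum over compositions of a set X is
    minus the sum, over all proper subsets Y of X, of the sums over the
    compositions of Y with the edges of w|_X/_Y added to every graph
    ([composition_sumS]).

    The signed sum over tubings obeys the same recursion ([tubing_sum_rec]).
    A tubing of w|_Y becomes a tubing of w|_X when the components of w|_X not
    contained in Y are added to it, and this adds the edges of w|_X/_Y to its
    graph ([edges_add_tops]).  Conversely, removing a nonempty set B of
    components of w|_X from a tubing t of w|_X leaves a tubing of w|_Y, with Y
    the union of the remaining tubes, and the components removed are those not
    contained in Y.  The key point is that a tube covered by a set of tubes of
    a tubing belongs to that set ([cover_in]).  So each t is obtained once for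
    every nonempty B, with sign (-1)^(|t| - |B|), and summing (-1)^|B| over
    the nonempty B gives -1.  Both sums therefore agree by induction.

    There is no cancellation because the sign can be read off the graph: the
    connected components of w(t) are the sets J minus t_{<J} for J in t, which
    are nonempty and pairwise disjoint, so there are |t| of them
    ([card_components_tubing_graph]). *)

(** * Edge sets and paths through a set of vertices *)

Section EdgeSets.

Variable V : finType.
Implicit Types (I J S T X Y : {set V}) (E : {set {set V}}).

Lemma edge_set_eq I E1 E2 :
    is_edge_set I E1 -> is_edge_set I E2 ->
    (forall u v, u != v -> ([set u; v] \in E1) = ([set u; v] \in E2)) ->
  E1 = E2.
Proof.
move=> /forall_inP edge1 /forall_inP edge2 eqE; apply/setP=> e.
apply/idP/idP => eE.
  have /andP[_ /cards2P[u [v [neq_uv def_e]]]] := edge1 _ eE.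
  by rewrite def_e -eqE // -def_e.
have /andP[_ /cards2P[u [v [neq_uv def_e]]]] := edge2 _ eE.
by rewrite def_e eqE // -def_e.
Qed.

Lemma edge_set_sub I J E : I \subset J -> is_edge_set I E -> is_edge_set J E.
Proof.
move=> sIJ /forall_inP edgeE; apply/forall_inP=> e /edgeE/andP[sub_e ->].
by rewrite (subset_trans sub_e).
Qed.

Lemma edge_setU I E1 E2 :
  is_edge_set I E1 -> is_edge_set I E2 -> is_edge_set I (E1 :|: E2).
Proof.
move=> /forall_inP edge1 /forall_inP edge2; apply/forall_inP=> e.
by rewrite inE => /orP[/edge1|/edge2].
Qed.

Lemma edge_setP I (w : sgraph I) : is_edge_set I (edges w).
Proof. by case: w. Qed.

Lemma in_edges_of I (r : rel V) u v :
  ([set u; v] \in edges_of I r)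
    = [&& u \in I, v \in I, u != v & r u v || r v u].
Proof. exact: adj_mk. Qed.

Lemma adj_in I (w : sgraph I) u v :
  adj w u v -> [/\ u \in I, v \in I & u != v].
Proof.
move=> /(forall_inP (edge_setP w))/andP[/subsetP sub_uv card_uv].
split; try by apply: sub_uv; rewrite !inE eqxx ?orbT.
by apply: contraTneq card_uv => ->; rewrite setUid cards1.
Qed.

Lemma adj_irr I (w : sgraph I) u : adj w u u = false.
Proof. by apply/negP=> /adj_in[_ _]; rewrite eqxx. Qed.

Lemma edges_of_eq I (r1 r2 : rel V) :
    (forall u v, u \in I -> v \in I -> u != v ->
       r1 u v || r1 v u = r2 u v || r2 v u) ->
  edges_of I r1 = edges_of I r2.
Proof.
move=> eq_r; apply: (@edge_set_eq I); try exact: edges_ofP.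
move=> u v neq_uv; rewrite !in_edges_of.
case: (boolP (u \in I)) => // Iu; case: (boolP (v \in I)) => // Iv.
by rewrite neq_uv /= eq_r.
Qed.

Lemma edges_of_adj I (w : sgraph I) : edges_of I (adj w) = edges w.
Proof.
apply: (@edge_set_eq I); [exact: edges_ofP | exact: edge_setP |].
move=> u v neq_uv; rewrite in_edges_of (adj_sym w v) orbb neq_uv /=.
apply/and3P/idP=> [[] // | e_uv].
by have [] := @adj_in _ w _ _ e_uv.
Qed.

Lemma restr_self I (w : sgraph I) : restr I w = w.
Proof. by apply/val_inj/edges_of_adj. Qed.

(** A walk that stays in [S] between its endpoints can be shortened to a path
    doing the same, so that distinctness of the vertices, awkward under
    concatenation, need not be tracked. *)
Lemma path_throughP I (w : sgraph I) S u v : u != v ->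
  reflect (exists2 p, path (adj w) u (rcons p v) & all [in S] p)
          (path_through w S u v).
Proof.
move=> neq_uv; apply: (iffP existsP) => [[n /existsP[p /and3P[_ wp Sp]]] | [p]].
  by exists p.
move=> wp Sp; have := last_rcons u p v.
case: (shortenP wp) => q wq Uq sub_qp last_q.
case/lastP: q => [|q v'] in wq Uq sub_qp last_q *.
  by rewrite -last_q /= eqxx in neq_uv.
rewrite last_rcons in last_q; rewrite {v'}last_q in wq Uq sub_qp.
have size_q : (size q < #|V|)%N.
  have := max_card [in u :: rcons q v]; rewrite (card_uniqP Uq) /= size_rcons.
  exact: leq_trans.
exists (Ordinal size_q); apply/existsP; exists (in_tuple q).
apply/and3P; split=> //; apply/allP=> x qx; apply: (allP Sp).
have : x \in rcons p v by apply: sub_qp; rewrite mem_rcons inE qx orbT.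
rewrite mem_rcons inE => /orP[/eqP def_x|//].
by move: Uq; rewrite /= rcons_uniq -def_x qx andbF.
Qed.

Lemma path_through_sub I (w : sgraph I) S S' u v :
  S \subset S' -> path_through w S u v -> path_through w S' u v.
Proof.
move=> /subsetP sSS' /existsP[n /existsP[p /and3P[Up wp Sp]]].
apply/existsP; exists n; apply/existsP; exists p.
by apply/and3P; split=> //; apply/allP=> x /(allP Sp)/sSS'.
Qed.

Lemma path_through0 I (w : sgraph I) u v : u != v ->
  path_through w set0 u v = adj w u v.
Proof.
move=> neq_uv; apply/(path_throughP _ _ neq_uv)/idP => [[[|x p]] /= | w_uv].
- by rewrite andbT.
- by rewrite inE.
by exists [::]; rewrite //= w_uv.
Qed.

Lemma path_through_sym I (w : sgraph I) S u v : u != v ->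
  path_through w S u v = path_through w S v u.
Proof.
move=> neq_uv; have neq_vu : v != u by rewrite eq_sym.
have symP x y : x != y -> path_through w S x y -> path_through w S y x.
  move=> neq_xy; have neq_yx : y != x by rewrite eq_sym.
  case/(path_throughP _ _ neq_xy) => p wp Sp.
  apply/(path_throughP _ _ neq_yx); exists (rev p); last by rewrite all_rev.
  have := rev_path (adj w) x (rcons p y).
  rewrite last_rcons belast_rcons rev_cons => ->.
  by rewrite -(@eq_path _ (adj w)) // => a b /=; rewrite adj_sym.
by apply/idP/idP; apply: symP.
Qed.

End EdgeSets.

(** * Tubes, components and tubings of induced subgraphs *)

Section Tubes.

Variables (V : finType) (I : {set V}) (w : sgraph I).
Implicit Types (J X Y : {set V}) (t D : {set {set V}}).

Lemma adj_restr X u v : adj (restr X w) u v = [&& u \in X, v \in X & adj w u v].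
Proof.
rewrite adj_mk (adj_sym w v) orbb; do 2![congr (_ && _)].
by apply/andb_idl=> /adj_in[].
Qed.

Lemma restr_restr J X : J \subset X -> restr J (restr X w) = restr J w.
Proof.
move=> /subsetP sJX; apply/val_inj/edges_of_eq => u v /sJX Xu /sJX Xv _.
by rewrite !adj_restr Xu Xv.
Qed.

Lemma connect_restr_sym X : connect_sym (adj (restr X w)).
Proof. exact/sym_connect_sym/adj_sym. Qed.

Lemma connect_restrS X Y x y : X \subset Y ->
  connect (adj (restr X w)) x y -> connect (adj (restr Y w)) x y.
Proof.
move=> /subsetP sXY; apply: connect_sub => u v.
rewrite adj_restr => /and3P[/sXY Yu /sXY Yv uv].
by rewrite connect1 ?adj_restr ?Yu ?Yv.
Qed.

(** Meant for [x] in [X]: the connected component of [x] in the induced subgraph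
    on [X], in the form in which [components] lists it. *)
Definition component X x : {set V} :=
  [set y in X | connect (adj (restr X w)) x y].

Lemma component_sub X x : component X x \subset X.
Proof. by apply/subsetP=> y; rewrite inE => /andP[]. Qed.

Lemma mem_component X x : x \in X -> x \in component X x.
Proof. by move=> Xx; rewrite inE Xx /=. Qed.

Lemma component_eq X x y : y \in component X x -> component X y = component X x.
Proof.
rewrite inE => /andP[_ xy]; apply/setP=> z; rewrite !inE.
by rewrite (same_connect (@connect_restr_sym X) xy).
Qed.

(** A path in the induced subgraph on [X] never leaves the component it starts
    in, which is what makes paths in [X] and in the component interchangeable. *)
Lemma component_path X x z p : z \in component X x ->
    path (adj w) z p -> all [in X] p ->
  path (adj (restr (component X x) w)) z p && all [in component X x] p.
Proof.
elim: p z => //= y p IHp z xz /andP[zy yp] /andP[Xy Xp].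
have xy : y \in component X x.
  move: xz; rewrite !inE Xy => /andP[Xz xz]; apply: connect_trans xz _.
  by rewrite connect1 // adj_restr Xz Xy.
by rewrite adj_restr xz xy zy /=; apply: IHp.
Qed.

Lemma restr_path X x p : x \in X ->
  path (adj (restr X w)) x p = path (adj w) x p && all [in X] p.
Proof.
elim: p x => //= y p IHp x Xx; rewrite adj_restr Xx /=.
case: (boolP (y \in X)) => Xy; last by rewrite andbF.
by rewrite IHp // andbA.
Qed.

Lemma tubeP J :
  reflect [/\ J != set0, J \subset I
            & {in J &, forall u v, connect (adj (restr J w)) u v}]
          (tube w J).
Proof.
apply: (iffP and3P) => [[nzJ sJI /forall_inP connJ] | [nzJ sJI connJ]]; split=> //.
  by move=> u v Ju Jv; have /forall_inP := connJ u Ju; apply.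
by apply/forall_inP=> u Ju; apply/forall_inP=> v; apply: connJ.
Qed.

Lemma tube_restr J X : X \subset I ->
  tube (restr X w) J = tube w J && (J \subset X).
Proof.
move=> sXI; have [sJX | nsJX] := boolP (J \subset X).
  by rewrite andbT /tube restr_restr // sJX (subset_trans sJX sXI).
by rewrite andbF; apply/negP=> /and3P[_]; rewrite (negPf nsJX).
Qed.

Lemma component_tube X x : X \subset I -> x \in X -> tube w (component X x).
Proof.
move=> sXI Xx; apply/tubeP; split.
- by apply/set0Pn; exists x; apply: mem_component.
- exact: subset_trans (component_sub _ _) sXI.
have from_x y : y \in component X x ->
    connect (adj (restr (component X x) w)) x y.
  rewrite inE => /andP[_ /connectP[p xp ->]]; apply/connectP; exists p => //.
  move: xp; rewrite restr_path // => /andP[xp Xp].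
  by have /andP[] := component_path (mem_component Xx) xp Xp.
move=> u v xu xv; apply: connect_trans (from_x v xv).
by rewrite connect_restr_sym from_x.
Qed.

Lemma tube_sub_component J X x :
  tube w J -> J \subset X -> x \in J -> J \subset component X x.
Proof.
move=> /tubeP[_ _ connJ] sJX Jx; apply/subsetP=> y Jy.
by rewrite inE (subsetP sJX) //= (connect_restrS sJX) ?connJ.
Qed.

Lemma componentS X Y x : X \subset Y -> component X x \subset component Y x.
Proof.
move=> sXY; apply/subsetP=> y; rewrite !inE => /andP[/(subsetP sXY)-> /=].
exact: connect_restrS.
Qed.

Definition laminar t :=
  {in t &, forall J1 J2, [|| [disjoint J1 & J2], J1 \subset J2 | J2 \subset J1]}.

(** The condition on unions of disjoint tubes, over all of [w]: for tubes inside
    [X] it does not change when [w] is restricted to [X]. *)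
Definition tube_free t := forall D : {set {set V}},
  D \subset t -> (2 <= #|D|)%N -> trivIset D -> ~~ tube w (cover D).

(** States what a tubing of an induced subgraph is in terms of the tubes of [w]
    itself, so that tubings of different induced subgraphs can be compared. *)
Lemma tubingP X t : X \subset I ->
  reflect [/\ {in t, forall J, tube w J /\ J \subset X}, laminar t, tube_free t
            & {in X, forall x, component X x \in t}]
          (tubing (restr X w) t).
Proof.
move=> sXI; apply: (iffP and4P).
  case=> /forall_inP tubes /forall_inP lam /forallP free /subsetP comps.
  have {}tubes J : J \in t -> tube w J /\ J \subset X.
    by move/tubes; rewrite tube_restr // => /andP.
  split=> // [J1 J2 tJ1 tJ2|D sDt D2 trivD|x Xx].
  - by have /forall_inP := lam J1 tJ1; apply.
  - have := free D; rewrite sDt D2 trivD /= tube_restr // negb_and.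
    have -> : cover D \subset X.
      by apply/bigcupsP=> J /(subsetP sDt)/tubes[].
    by rewrite orbF.
  by apply: comps; apply: imset_f.
case=> tubes lam free comps; split.
- by apply/forall_inP=> J /tubes[tubeJ sJX]; rewrite tube_restr // tubeJ.
- by apply/forall_inP=> J1 tJ1; apply/forall_inP=> J2 tJ2; apply: lam.
- apply/forallP=> D; apply/implyP=> /and3P[sDt D2 trivD].
  by rewrite tube_restr // negb_and free.
by apply/subsetP=> _ /imsetP[x Xx ->]; apply: comps.
Qed.

(** The inclusion-maximal members of [D] are pairwise disjoint with the same
    union, so a tube cannot be covered by [D] unless it is the only one. *)
Lemma cover_in t D : laminar t -> tube_free t -> D \subset t ->
  tube w (cover D) -> cover D \in D.
Proof.
move=> lam free sDt tubeD; pose M := [set J | maxset [in D] J].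
have sMD : M \subset D by apply/subsetP=> J; rewrite inE => /maxsetp.
have coverM : cover M = cover D.
  apply/eqP; rewrite eqEsubset; apply/andP; split; apply/bigcupsP=> J DJ.
    exact/bigcup_sup/(subsetP sMD).
  have [J' maxJ' sJJ'] := @maxset_exists _ [in D] J DJ.
  by apply: subset_trans sJJ' _; apply: bigcup_sup; rewrite inE.
have trivM : trivIset M.
  apply/trivIsetP=> A B; rewrite !inE => /maxsetP[DA maxA] /maxsetP[DB maxB].
  have /or3P[-> // | sAB | sBA] := lam A B (subsetP sDt _ DA) (subsetP sDt _ DB).
    by rewrite (maxA B DB sAB) eqxx.
  by rewrite (maxB A DA sBA) eqxx.
have M1: (#|M| <= 1)%N.
  rewrite leqNgt; apply/negP=> M2.
  by have /negP := free M (subset_trans sMD sDt) M2 trivM; rewrite coverM.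
rewrite -coverM in tubeD *; have nzM : M != set0.
  by apply: contraTneq tubeD => ->; rewrite /cover big_set0 /tube eqxx.
have /cards1P[J def_M] : #|M| == 1%N by rewrite eqn_leq M1 card_gt0.
by rewrite {1}def_M /cover big_set1 (subsetP sMD) // def_M set11.
Qed.

End Tubes.

(** * Adding and removing top tubes *)

Section TopTubes.

Variables (V : finType) (I : {set V}) (w : sgraph I).
Implicit Types (J X Y : {set V}) (t B : {set {set V}}).

Lemma tube_meets_component X x J : tube w J -> J \subset X ->
  J \subset component w X x \/ [disjoint J & component w X x].
Proof.
move=> tubeJ sJX; have [disj | ] := boolP [disjoint J & component w X x].
  by right.
case/pred0Pn=> y /= /andP[Jy xy]; left.
by rewrite -(component_eq xy); apply: tube_sub_component.
Qed.

Lemma cover_tubing X t : X \subset I -> tubing (restr X w) t -> cover t = X.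
Proof.
move=> sXI /(tubingP w _ sXI)[tubes _ _ comps]; apply/eqP; rewrite eqEsubset.
apply/andP; split; first by apply/bigcupsP=> J /tubes[].
apply/subsetP=> x Xx; apply/bigcupP; exists (component w X x).
  exact: comps.
exact: mem_component.
Qed.

(** The components of the induced subgraph on [X] that are not contained in [Y],
    each written through one of its vertices outside [Y].  They are the tubes to
    be put on top of a tubing of the induced subgraph on [Y]. *)
Definition tops X Y : {set {set V}} := [set component w X x | x in X :\: Y].

Lemma topsP X Y C : reflect (exists x, [/\ x \in X, x \notin Y & C = component w X x])
  (C \in tops X Y).
Proof.
apply: (iffP imsetP) => [[x /setDP[Xx Yx] ->] | [x [Xx Yx ->]]].
  by exists x.
by exists x; rewrite // inE Yx.
Qed.

Lemma tops_sub X Y C : C \in tops X Y -> ~~ (C \subset Y).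
Proof.
case/topsP=> x [Xx Yx ->]; apply: contra Yx => /subsetP; apply.
exact: mem_component.
Qed.

Lemma disjoint_tops X Y t :
  Y \subset I -> tubing (restr Y w) t -> [disjoint t & tops X Y].
Proof.
move=> sYI tubing_t; rewrite disjoint_sym; apply/pred0P=> C /=.
apply/negP=> /andP[/tops_sub/negP nCY tC]; case: nCY.
by rewrite -(cover_tubing sYI tubing_t) bigcup_sup.
Qed.

Lemma tops_proper X Y : Y \proper X -> tops X Y != set0.
Proof.
case/properP=> _ [x Xx Yx]; apply/set0Pn; exists (component w X x).
by apply/topsP; exists x.
Qed.

(** The delicate condition is the one on unions: if a disjoint family contains
    a new tube [C], a component of the graph on [X], then a connected union would
    be contained in [C], leaving no room for a second member. *)
Lemma tubing_add_tops X Y t : X \subset I -> Y \proper X ->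
  tubing (restr Y w) t -> tubing (restr X w) (t :|: tops X Y).
Proof.
move=> sXI /proper_sub sYX tubing_t; have sYI := subset_trans sYX sXI.
have [tubes lam free comps] := tubingP w t sYI tubing_t.
have new_tube J : J \in t :|: tops X Y -> tube w J /\ J \subset X.
  case/setUP=> [/tubes[tubeJ sJY] | /topsP[x [Xx _ ->]]].
    by split; last exact: subset_trans sYX.
  by split; [apply: component_tube | apply: component_sub].
apply/(tubingP w _ sXI); split=> // [J1 J2|D sDt D2 trivD|x Xx].
- move=> tJ1 tJ2; have [tube1 s1X] := new_tube _ tJ1.
  have [tube2 s2X] := new_tube _ tJ2.
  case/setUP: tJ1 => [tJ1|/topsP[x [Xx _ def1]]]; last first.
    have [|] := tube_meets_component x tube2 s2X; rewrite -def1.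
      by move=> ->; rewrite !orbT.
    by rewrite disjoint_sym => ->.
  case/setUP: tJ2 => [tJ2|/topsP[x [Xx _ def2]]]; first exact: lam.
  by have [|] := tube_meets_component x tube1 s1X; rewrite -def2 => ->; rewrite ?orbT.
- have [sDt' | nDt'] := boolP (D \subset t); first exact: free.
  have [C DC tC] := subsetPn nDt'.
  have /setUP[|/topsP[x [Xx _ defC]]] := subsetP sDt _ DC.
    by rewrite (negPf tC).
  apply/negP=> tube_cover.
  have sDX : cover D \subset X.
    by apply/bigcupsP=> J /(subsetP sDt)/new_tube[].
  have Cx : x \in C by rewrite defC mem_component.
  have sDC : cover D \subset C.
    by rewrite defC tube_sub_component //; apply/bigcupP; exists C.
  have /set0Pn[J /setD1P[neqJC DJ]] : D :\ C != set0.
    by rewrite -card_gt0; move: D2; rewrite (cardsD1 C) DC.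
  have disjJC := trivIsetP trivD _ _ DJ DC neqJC.
  have [/tubeP[/set0Pn[y Jy] _ _] _] := new_tube _ (subsetP sDt _ DJ).
  have Cy : y \in C by apply: (subsetP sDC); apply/bigcupP; exists J.
  by move: (disjointFr disjJC Jy); rewrite Cy.
have [sCY | /subsetPn[y xy Yy]] := boolP (component w X x \subset Y); last first.
  apply/setUP; right; apply/topsP; exists y; split=> //.
    exact: (subsetP (component_sub _ _ _)) xy.
  by rewrite (component_eq xy).
have Yx : x \in Y by apply: (subsetP sCY); apply: mem_component.
apply/setUP; left; suff -> : component w X x = component w Y x by apply: comps.
apply/eqP; rewrite eqEsubset (componentS w x sYX) andbT.
by rewrite tube_sub_component ?mem_component ?component_tube.
Qed.

Section RemoveTops.

Variables (X : {set V}) (t B : {set {set V}}).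
Hypothesis sXI : X \subset I.
Hypothesis tubing_t : tubing (restr X w) t.
Hypothesis sBX : B \subset components (restr X w).

Let Y := cover (t :\: B).

Let sYX : Y \subset X.
Proof.
rewrite -(cover_tubing sXI tubing_t); apply/bigcupsP=> J /setDP[tJ _].
exact: bigcup_sup.
Qed.

(** The remaining tubes that meet a component of their union [Y] cover it, so by
    [cover_in] that component is itself one of them. *)
Lemma component_cover_diff y : y \in Y -> component w Y y \in t :\: B.
Proof.
have [tubes lam free comps] := tubingP w t sXI tubing_t.
move=> Yy; set C := component w Y y.
pose D := [set J in t :\: B | J \subset C].
have def_C : cover D = C.
  apply/eqP; rewrite eqEsubset; apply/andP; split.
    by apply/bigcupsP=> J; rewrite inE => /andP[].
  apply/subsetP=> x Cx; have Yx : x \in Y by move: Cx; rewrite inE => /andP[].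
  have [J tJ Jx] := bigcupP Yx; apply/bigcupP; exists J => //; rewrite inE tJ /=.
  have [tubeJ _] : tube w J /\ J \subset X by apply: tubes; case/setDP: tJ.
  have sJY : J \subset Y by apply: bigcup_sup.
  by rewrite /C -(component_eq Cx) tube_sub_component.
have sDtB : D \subset t :\: B by apply/subsetP=> J; rewrite inE => /andP[].
apply: (subsetP sDtB); rewrite -[in X in X \in _]def_C.
apply: (cover_in lam free (subset_trans sDtB (subsetDl _ _))).
by rewrite def_C component_tube // (subset_trans sYX).
Qed.

Lemma tubing_remove_tops : tubing (restr Y w) (t :\: B).
Proof.
have [tubes lam free comps] := tubingP w t sXI tubing_t.
apply/(tubingP w _ (subset_trans sYX sXI)); split.
- move=> J tJ; split; last exact: bigcup_sup.
  by have /setDP[/tubes[]] := tJ.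
- by move=> J1 J2 /setDP[tJ1 _] /setDP[tJ2 _]; apply: lam.
- move=> D /subset_trans/(_ (subsetDl _ _)) sDt; exact: free.
by move=> y; apply: component_cover_diff.
Qed.

Lemma tops_remove_tops : tops X Y = B.
Proof.
have [tubes lam free comps] := tubingP w t sXI tubing_t.
apply/setP=> C; apply/topsP/idP => [[x [Xx Yx ->]]|BC].
  apply: contraR Yx => nBC; apply/bigcupP; exists (component w X x).
    by rewrite inE nBC comps.
  exact: mem_component.
have /imsetP[x Xx def_C] := subsetP sBX _ BC.
have [sCY | /subsetPn[y Cy Yy]] := boolP (C \subset Y); last first.
  exists y; move: Cy; rewrite def_C => Cy; split=> //.
    exact: (subsetP (component_sub w X x)).
  by rewrite (component_eq Cy).
have Yx : x \in Y by apply: (subsetP sCY); rewrite def_C mem_component.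
have /setDP[_ /negP[]] := component_cover_diff Yx; suff <- : C = component w Y x by [].
apply/eqP; rewrite eqEsubset {2}def_C (componentS w x sYX) andbT.
by rewrite tube_sub_component // def_C ?mem_component ?component_tube.
Qed.

Lemma remove_tops_proper : B != set0 -> Y \proper X.
Proof.
rewrite properE sYX -tops_remove_tops => /set0Pn[C /topsP[x [Xx Yx _]]].
by apply/subsetPn; exists x.
Qed.

End RemoveTops.

End TopTubes.

(** * The graph of a tubing *)

Section TubingGraph.

Variables (V : finType) (I : {set V}) (w : sgraph I).
Implicit Types (J S X Y : {set V}) (t : {set {set V}}).

(** Allows paths to be taken in the whole graph [w]: if the endpoints and [S] lie
    in [J], the path stays in [J] anyway. *)
Lemma path_through_restr J S u v :
    S \subset J -> u \in J -> v \in J -> u != v ->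
  path_through (restr J w) S u v = path_through w S u v.
Proof.
move=> /subsetP sSJ Ju Jv neq_uv.
apply/(path_throughP _ _ neq_uv)/(path_throughP _ _ neq_uv) => -[p wp Sp].
  by exists p => //; move: wp; rewrite restr_path // => /andP[].
exists p => //; rewrite restr_path // wp all_rcons Jv /=.
by apply/allP=> x /(allP Sp)/sSJ.
Qed.

Lemma below_sub t J : below t J \subset J.
Proof. by apply/bigcupsP=> A /andP[_ /proper_sub]. Qed.

Lemma adj_tube_graph t J u v : u != v ->
  adj (tube_graph w t J) u v
    = [&& u \in J :\: below t J, v \in J :\: below t J
        & path_through w (below t J) u v].
Proof.
move=> neq_uv; rewrite adj_mk neq_uv /=.
have neq_vu : v != u by rewrite eq_sym.
case: (boolP (u \in _)) => //= /setDP[Ju _].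
case: (boolP (v \in _)) => //= /setDP[Jv _].
rewrite !path_through_restr ?below_sub // (path_through_sym _ _ neq_vu).
exact: orbb.
Qed.

Lemma adj_tubing_graph t u v : {in t, forall J, J \subset I} ->
  reflect (u != v /\ exists2 J, J \in t
             & [/\ u \in J :\: below t J, v \in J :\: below t J
                 & path_through w (below t J) u v])
          (adj (tubing_graph w t) u v).
Proof.
move=> stI; have [-> | neq_uv] := eqVneq u v.
  by rewrite adj_irr; constructor=> -[].
have neq_vu : v != u by rewrite eq_sym.
rewrite adj_mk neq_uv /=; apply: (iffP and3P).
  case=> _ _ /orP[] /exists_inP[J tJ]; rewrite adj_tube_graph // => /and3P[].
    by split=> //; exists J.
  by rewrite path_through_sym //; split=> //; exists J.
case=> _ [J tJ [Ju Jv wuv]]; have /subsetP sJI := stI J tJ.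
split; first by apply: sJI; case/setDP: Ju.
  by apply: sJI; case/setDP: Jv.
by apply/orP; left; apply/exists_inP; exists J; rewrite // adj_tube_graph // Ju Jv.
Qed.

(** A new tube [J] is a component of the graph on [X], so the tubes inside it are
    those of [t] that it contains; they include all components of the graph on
    [Y] that meet [J], hence cover [J :&: Y]. *)
Lemma below_add_tops X Y t J : X \subset I -> Y \proper X ->
    tubing (restr Y w) t -> J \in t :|: tops w X Y ->
  below (t :|: tops w X Y) J = if J \in t then below t J else J :&: Y.
Proof.
move=> sXI properYX tubing_t tJ; have sYX := proper_sub properYX.
have sYI := subset_trans sYX sXI.
have [tubes lam free comps] := tubingP w t sYI tubing_t.
apply/eqP; rewrite eqEsubset; apply/andP; split.
  apply/bigcupsP=> A /andP[/setUP tA properAJ]; have sAJ := proper_sub properAJ.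
  case: ifP tJ => [tJ _|ntJ].
    case: tA => [tA|/tops_sub/negP[]]; first by apply: bigcup_sup; rewrite tA.
    by apply: subset_trans sAJ _; have [] := tubes J tJ.
  rewrite !inE ntJ /= => /topsP[x [Xx Yx def_J]].
  case: tA => [tA|/topsP[y [Xy Yy def_A]]].
    by rewrite subsetI sAJ; have [] := tubes A tA.
  have Jy : y \in J by rewrite (subsetP sAJ) // def_A mem_component.
  rewrite def_J in Jy.
  by move: properAJ; rewrite def_J def_A (component_eq Jy) properE subxx.
case: ifP tJ => [tJ _|ntJ].
  apply/bigcupsP=> A /andP[tA properAJ]; apply: bigcup_sup.
  by rewrite inE tA.
rewrite !inE ntJ /= => /topsP[x [Xx Yx def_J]].
apply/subsetP=> y /setIP[Jy Yy]; apply/bigcupP; exists (component w Y y).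
  rewrite !inE comps //= properE; apply/andP; split.
    by rewrite def_J; rewrite def_J in Jy; rewrite -(component_eq Jy) componentS.
  apply/subsetPn; exists x; first by rewrite def_J mem_component.
  by apply: contra Yx; apply: (subsetP (component_sub _ _ _)).
exact: mem_component.
Qed.

(** The edges inside a new tube [J] come from paths through [J :&: Y].  A path
    between vertices of [X] through [Y] stays in one component of the graph on
    [X], so these are all the edges of the graph on [X] with [Y] ripped out. *)
Lemma edges_add_tops X Y t : X \subset I -> Y \proper X ->
    tubing (restr Y w) t ->
  edges (tubing_graph w (t :|: tops w X Y))
    = edges (tubing_graph w t) :|: edges_of (X :\: Y) (path_through w Y).
Proof.
move=> sXI properYX tubing_t; have sYX := proper_sub properYX.
have sYI := subset_trans sYX sXI; set t' := t :|: _.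
have stI : {in t, forall J, J \subset I}.
  by move=> J; have [tubes _ _ _] := tubingP w t sYI tubing_t; case/tubes=> /tubeP[].
have st'I : {in t', forall J, J \subset I}.
  have tubing_t' := tubing_add_tops sXI properYX tubing_t.
  by move=> J; have [tubes _ _ _] := tubingP w t' sXI tubing_t'; case/tubes=> /tubeP[].
apply: (@edge_set_eq _ I); first exact: edge_setP.
  apply: edge_setU; first exact: edge_setP.
  apply: edge_set_sub (edges_ofP _ _).
  by apply: subset_trans sXI; apply: subsetDl.
move=> u v neq_uv; rewrite [RHS]in_setU.
rewrite -[LHS]/(adj _ u v) -[X in _ = X || _]/(adj _ u v).
rewrite [X in _ = _ || X]in_edges_of neq_uv andTb.
rewrite (path_through_sym w Y (u := v)) 1?eq_sym // orbb.
apply/(adj_tubing_graph _ _ st'I)/idP.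
  case=> _ [J t'J]; rewrite below_add_tops //.
  case: ifP t'J => [tJ _ uvJ|ntJ].
    by apply/orP; left; apply/adj_tubing_graph => //; split=> //; exists J.
  rewrite !inE ntJ /= => /topsP[x [Xx Yx def_J]] [/andP[+ Ju] /andP[+ Jv] wuv].
  have sJX : J \subset X by rewrite def_J component_sub.
  rewrite Ju Jv /= !(subsetP sJX) // => -> ->.
  by rewrite (path_through_sub (subsetIr J Y)) ?orbT.
case/orP=> [/(adj_tubing_graph _ _ stI)[_ [J tJ uvJ]]|].
  split=> //; exists J; rewrite ?below_add_tops ?tJ //.
    by rewrite inE tJ.
  by rewrite inE tJ.
case/and3P=> /setDP[Xu Yu] /setDP[Xv Yv] /(path_throughP _ _ neq_uv)[p wp Yp].
have topsJ : component w X u \in tops w X Y by apply/topsP; exists u.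
have t'J : component w X u \in t' by rewrite inE topsJ orbT.
split=> //; exists (component w X u) => //; rewrite below_add_tops //.
rewrite (disjointFl (disjoint_tops X sYI tubing_t)) //.
have Xp : all [in X] (rcons p v).
  by rewrite all_rcons Xv; apply/allP=> y /(allP Yp)/(subsetP sYX).
have /andP[_] := component_path (mem_component w Xu) wp Xp.
rewrite all_rcons => /andP[Jv Jp].
rewrite !inE in Jv *; rewrite (negPf Yu) (negPf Yv) Xu Jv !andbF /=; split=> //.
apply/(path_throughP _ _ neq_uv); exists p => //.
by apply/allP=> y py; rewrite inE (allP Jp) ?(allP Yp).
Qed.

End TubingGraph.

(** * The signed sum over tubings *)

(** Expand the product over the elements of [C] of the zero factors (-1) + 1. *)
Lemma sum_sign_subset (R : comNzRingType) (T : finType) (C : {set T}) :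
  C != set0 -> \sum_(B : {set T} | B \subset C) (-1) ^+ #|B| = 0 :> R.
Proof.
case/set0Pn=> c Cc; pose F x : R := if x \in C then -1 else 0.
transitivity (\prod_x (F x + 1)); last first.
  by rewrite (bigD1 c) //= /F Cc addNr mul0r.
rewrite bigA_distr big_mkcond; apply: eq_bigr => B _ /=.
rewrite -big_mkcond /=; case: ifPn => [/subsetP sBC | /subsetPn[x Bx Cx]].
  rewrite -prodr_const; apply: eq_bigr => x Bx.
  by rewrite /F sBC.
by rewrite (bigD1 x) //= /F (negPf Cx) mul0r.
Qed.

Local Arguments tubing_graph : simpl never.

Section TubingSum.

Variables (R : comNzRingType) (M : lmodType R).
Variables (V : finType) (I : {set V}) (w : sgraph I).
Implicit Types (X Y : {set V}) (t B : {set {set V}}).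
Implicit Types (phi : {set {set V}} -> M).

(** The edge sets are fed to an arbitrary function [phi], so that adding edges
    to every graph of the sum is a change of [phi]; this is how the sums over
    different vertex sets are related. *)
Definition tubing_sum X phi : M :=
  \sum_(t | tubing (restr X w) t) (-1) ^+ #|t| *: phi (edges (tubing_graph w t)).

(** Pairs (proper subset [Y], tubing of the graph on [Y]) correspond to pairs
    (tubing of the graph on [X], nonempty set [B] of its components), by adding
    or removing [B]. *)
Lemma tubing_sum_rec X phi : X \subset I -> X != set0 ->
  tubing_sum X phi
    = - \sum_(Y : {set V} | Y \proper X)
          tubing_sum Y (fun E => phi (E :|: edges_of (X :\: Y) (path_through w Y))).
Proof.
move=> sXI nzX; rewrite /tubing_sum pair_big_dep /=.
pose add (p : {set V} * {set {set V}}) := (p.2 :|: tops w X p.1, tops w X p.1).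
pose rem (p : {set {set V}} * {set {set V}}) := (cover (p.1 :\: p.2), p.1 :\: p.2).
have addK (p : {set V} * {set {set V}}) :
    (p.1 \proper X) && tubing (restr p.1 w) p.2 -> rem (add p) = p.
  case: p => Y t /= /andP[properYX tubing_t]; rewrite /rem /add /=.
  have sYI := subset_trans (proper_sub properYX) sXI.
  have -> : (t :|: tops w X Y) :\: tops w X Y = t.
    apply/setP=> J; rewrite !inE.
    have := disjointFr (disjoint_tops X sYI tubing_t) (x := J).
    by case: (J \in t) => [->|_] //=; case: (J \in tops w X Y).
  by rewrite (cover_tubing sYI tubing_t).
pose comps := components (restr X w).
have nz_comps : comps != set0.
  have /set0Pn[x Xx] := nzX; apply/set0Pn; exists (component w X x).
  exact: imset_f.
have removeE t B : tubing (restr X w) t -> B \subset comps -> B != set0 ->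
    [/\ cover (t :\: B) \proper X, tubing (restr (cover (t :\: B)) w) (t :\: B),
        tops w X (cover (t :\: B)) = B, B \subset t & t :\: B :|: B = t].
  move=> tubing_t sBc nzB; have [_ _ _ cs] := tubingP w t sXI tubing_t.
  have sBt : B \subset t.
    by apply: subset_trans sBc _; apply/subsetP=> _ /imsetP[x Xx ->]; apply: cs.
  split=> //; last by rewrite -{2}(setIidPr sBt) setUC setID.
  - exact: remove_tops_proper sXI tubing_t sBc nzB.
  - exact: tubing_remove_tops sXI tubing_t.
  exact: tops_remove_tops sXI tubing_t sBc.
rewrite (reindex_onto rem add addK) /=.
transitivity (- \sum_(p : {set {set V}} * {set {set V}} |
   tubing (restr X w) p.1 && (p.2 \subset comps) && (p.2 != set0))
    (-1) ^+ #|p.2| *: ((-1) ^+ #|p.1| *: phi (edges (tubing_graph w p.1)))); last first.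
  congr (- _).
  have pred_eq (p : {set {set V}} * {set {set V}}) :
      tubing (restr X w) p.1 && (p.2 \subset comps) && (p.2 != set0)
        = ((rem p).1 \proper X) && tubing (restr (rem p).1 w) (rem p).2
          && (add (rem p) == p).
    case: p => t B; apply/idP/idP.
      case/andP=> /andP[tubing_t sBc] nzB; rewrite /rem /add [(_, _).1]/= [(_, _).2]/=.
      by have [-> -> -> _ ->] := removeE t B tubing_t sBc nzB; rewrite eqxx.
    case/andP=> /andP[properYX tubing_t'] /eqP[def_t def_B].
    have := tubing_add_tops sXI properYX tubing_t'; rewrite def_t => -> /=.
    apply/andP; split; last by rewrite -def_B tops_proper.
    by rewrite -def_B; apply/subsetP=> _ /topsP[x [Xx _ ->]]; apply: imset_f.
  apply: eq_big => [|[t B]]; first exact: pred_eq.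
  case/andP=> /andP[tubing_t sBc] nzB; rewrite /=.
  have [properYX tubing_t' tops_B sBt def_t] := removeE t B tubing_t sBc nzB.
  have := edges_add_tops sXI properYX tubing_t'; rewrite tops_B def_t => <-.
  rewrite scalerA -exprD; congr (_ *: _).
  rewrite cardsD (setIidPr sBt) -[LHS]signr_odd -[RHS]signr_odd oddD.
  by rewrite oddB ?subset_leq_card // addbC.
transitivity (- \sum_(t | tubing (restr X w) t)
   \sum_(B : {set {set V}} | (B \subset comps) && (B != set0))
     (-1) ^+ #|B| *: ((-1) ^+ #|t| *: phi (edges (tubing_graph w t)))); last first.
  congr (- _); rewrite pair_big; apply: eq_bigl => p; exact: andbA.
rewrite -sumrN; apply: eq_bigr => t tubing_t.
rewrite -scaler_suml -scaleNr -[LHS]scale1r; congr (_ *: _).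
have := sum_sign_subset R nz_comps; rewrite (bigD1 set0) ?sub0set //=.
by rewrite cards0 expr0 => /eqP; rewrite addr_eq0 => /eqP.
Qed.

End TubingSum.

(** * The signed sum over compositions *)

Section CompositionSum.

Variables (R : comNzRingType) (M : lmodType R).
Variables (V : finType) (I : {set V}) (w : sgraph I).
Implicit Types (X Y A P : {set V}) (s : seq {set V}).
Implicit Types (phi : {set {set V}} -> M).

(** The edges of the graph of the composition [s] when the vertices of [P] have
    already been ripped out. *)
Fixpoint composition_edges P s : {set {set V}} :=
  if s is A :: s' then
    edges_of A (path_through w P) :|: composition_edges (P :|: A) s'
  else set0.

Lemma cupseq_cons A s : cupseq (A :: s) = A :|: cupseq s.
Proof. by case: s => //=; rewrite setU0. Qed.

Lemma cupseq_rcons s A : cupseq (rcons s A) = cupseq s :|: A.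
Proof.
elim: s => [|B s IHs]; first by rewrite /= set0U.
by rewrite rcons_cons !cupseq_cons IHs setUA.
Qed.

Lemma composition_edges_rcons P s A :
  composition_edges P (rcons s A)
    = composition_edges P s :|: edges_of A (path_through w (P :|: cupseq s)).
Proof.
elim: s P => [|B s IHs] P; first by rewrite /= !setU0 set0U.
by rewrite rcons_cons cupseq_cons /= IHs -!setUA.
Qed.

Lemma disjoint_cupseq A s :
  all (fun S : {set V} => [disjoint S & A]) s = [disjoint cupseq s & A].
Proof.
elim: s => [|B s IHs]; first by rewrite disjoints_subset sub0set.
by rewrite cupseq_cons disjoints_subset subUset -!disjoints_subset /= IHs.
Qed.

Lemma is_composition_rcons X s A :
  is_composition X (rcons s A)
    = [&& A != set0, A \subset X & is_composition (X :\: A) s].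
Proof.
rewrite /is_composition all_rcons pairwise_rcons cupseq_rcons disjoint_cupseq.
rewrite -!andbA; congr (_ && _); rewrite andbCA; apply/and4P/and4P.
  case=> disj s0 pw /eqP def_X; split=> //; rewrite -?def_X ?subsetUr //.
  by rewrite setDUl setDv setU0 (setDidPl disj).
case=> sAX s0 pw /eqP def_s; split=> //; rewrite def_s.
  by rewrite disjoint_sym disjoints_subset setCD subsetUr.
by rewrite setUC -{1}(setIidPr sAX) setID.
Qed.

Definition composition_sum k X phi : M :=
  \sum_(c : k.-tuple {set V} | is_composition X c)
     phi (composition_edges set0 c).

Lemma composition_sum0 X phi :
  composition_sum 0 X phi = if X == set0 then phi set0 else 0.
Proof.
rewrite /composition_sum eq_sym; case: ifP => [/eqP<- | nzX].
  rewrite (big_pred1 [tuple]) // => c; rewrite tuple0 /is_composition /=.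
  by rewrite !eqxx.
by rewrite big_pred0 // => c; rewrite tuple0 /is_composition /= nzX.
Qed.

(** A composition of [X] is a composition of a proper subset [Y], followed by the
    block [X :\: Y]. *)
Lemma composition_sumS k X phi :
  composition_sum k.+1 X phi
    = \sum_(Y : {set V} | Y \proper X)
        composition_sum k Y
          (fun E => phi (E :|: edges_of (X :\: Y) (path_through w Y))).
Proof.
rewrite /composition_sum pair_big_dep /=.
pose add (p : {set V} * k.-tuple {set V}) := [tuple of rcons p.2 (X :\: p.1)].
pose rem (c : k.+1.-tuple {set V}) : {set V} * k.-tuple {set V} :=
  (X :\: last (thead c) (behead c), [tuple of belast (thead c) (behead c)]).
have remK (c : k.+1.-tuple {set V}) : is_composition X c -> add (rem c) = c.
  move=> comp_c; apply: val_inj; rewrite /= setDDr setDv set0U.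
  case/tupleP: c comp_c => A c; rewrite /thead tnth0 /=.
  by rewrite lastI is_composition_rcons => /and3P[_ /setIidPr-> _].
have rem_rcons A (c : k.-tuple {set V}) : rem [tuple of rcons c A] = (X :\: A, c).
  have /rcons_inj[eq_c eq_A] :
      rcons (belast (thead [tuple of rcons c A]) (behead (rcons c A)))
        (last (thead [tuple of rcons c A]) (behead (rcons c A))) = rcons c A.
    by rewrite -lastI; have /(congr1 val) := tuple_eta [tuple of rcons c A].
  by congr (_, _); [rewrite /= eq_A | apply: val_inj].
have addE Y (c : k.-tuple {set V}) :
    is_composition X (rcons c (X :\: Y)) && (rem (add (Y, c)) == (Y, c))
      = (Y \proper X) && is_composition Y c.
  rewrite /add rem_rcons xpair_eqE eqxx andbT is_composition_rcons subsetDl /=.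
  rewrite setDDr setDv set0U properE -[X \subset Y]setD_eq0 -andbA andbC -andbA.
  have -> : (X :&: Y == Y) = (Y \subset X) by apply/eqP/setIidPr.
  case: (boolP (Y \subset X)) => [/setIidPr->|_].
    by rewrite /= andbC.
  by rewrite /= andbF.
rewrite (reindex_onto add rem remK) /=.
apply: eq_big => [[Y c]|[Y c]] /=; rewrite addE // => /andP[_ /and3P[_ _ /eqP def_c]].
by rewrite composition_edges_rcons set0U def_c.
Qed.

(** Any [n] above [#|X|] gives the same sum, as no composition of [X] has more
    than [#|X|] blocks; the slack in [n] lets the induction pass to all proper
    subsets at once. *)
Lemma alternating_composition_sum n X phi : (#|X| < n)%N -> X \subset I ->
  \sum_(k < n) (-1) ^+ k *: composition_sum k X phi = tubing_sum w X phi.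
Proof.
elim: n X phi => // n IHn X phi ltXn sXI.
rewrite big_ord_recl /= expr0 scale1r composition_sum0.
have [X0 | nzX] := eqVneq X set0; last first.
  rewrite add0r tubing_sum_rec //.
  under eq_bigr => k _ do rewrite composition_sumS exprS mulN1r scaleNr scaler_sumr.
  rewrite sumrN; congr (- _). rewrite exchange_big; apply: eq_bigr => Y properYX.
  apply: IHn; last exact: subset_trans (proper_sub properYX) sXI.
  exact: leq_trans (proper_card properYX) _.
rewrite big1 ?addr0 => [|k _]; last first.
  rewrite composition_sumS big_pred0 ?scaler0 // => Y.
  by rewrite X0 properE sub0set andbF.
have tubing_set0 t : tubing (restr X w) t = (t == set0).
  apply/(tubingP w t sXI)/eqP => [[tubes _ _ _]| ->].
    apply/eqP; rewrite -subset0; apply/subsetP=> J /tubes[/tubeP[nzJ _ _]].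
    by rewrite X0 subset0 (negPf nzJ).
  split=> [J|J1 J2|D|x]; rewrite ?inE //; last by rewrite X0 inE.
  by rewrite subset0 => /eqP->; rewrite cards0.
rewrite /tubing_sum (big_pred1 set0) // cards0 expr0 scale1r; congr phi.
apply/esym/(@edge_set_eq _ I); first exact: edge_setP.
  by apply/forall_inP=> e; rewrite inE.
move=> u v neq_uv; rewrite [RHS]inE.
rewrite -[_ \in edges _]/(adj _ u v); apply/adj_tubing_graph=> [J|[_ [J]]].
  by rewrite inE.
by rewrite inE.
Qed.

End CompositionSum.

(** * Iterated products and coproducts on basis elements *)

Section FreeModuleBasis.

Variable K : fieldType.
Implicit Types A B C D : finType.

Lemma lin_ext_basis A B (f : A -> free_on K B) a :
  lin_ext f (basis_vec K a) = f a.
Proof.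
rewrite /lin_ext (bigD1 a) //= ffunE eqxx scale1r big1 ?addr0 // => b neq_ba.
by rewrite ffunE eq_sym (negPf neq_ba) scale0r.
Qed.

Lemma tensor_basis A B (a : A) (b : B) :
  tensor (basis_vec K a) (basis_vec K b) = basis_vec K (a, b).
Proof.
by apply/ffunP=> -[c d]; rewrite !ffunE xpair_eqE mulr_natl mulrb; case: ifP.
Qed.

Lemma tensor_map_basis A B C D
    (f : free_on K A -> free_on K C) (g : free_on K B -> free_on K D)
    (a : A) (b : B) (c : C) (d : D) :
    f (basis_vec K a) = basis_vec K c -> g (basis_vec K b) = basis_vec K d ->
  tensor_map f g (basis_vec K (a, b)) = basis_vec K (c, d).
Proof. by move=> fa gb; rewrite /tensor_map lin_ext_basis fa gb tensor_basis. Qed.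

End FreeModuleBasis.

Section IteratedCoproduct.

Variables (K : fieldType) (V : finType) (I : {set V}) (w : sgraph I).
Implicit Types (P A X : {set V}) (s : seq {set V}).

(** On [X], the graph [w'] is [w] with [P] ripped out.  Stated on adjacencies
    rather than as an equality of graphs, because the factors of an iterated
    coproduct have different types. *)
Definition agrees_with_rip P X (w' : sgraph X) :=
  {in X &, forall u v, u != v -> adj w' u v = path_through w P u v}.

(** Coassociativity of ripping.  A path of [w'] is expanded edge by edge into a
    walk of [w] through [P]; conversely a walk of [w] through [P :|: A] is cut at
    its vertices outside [P], each piece being an edge of [w'] or trivial. *)
Lemma path_through_rip P X (w' : sgraph X) A u v :
    agrees_with_rip P w' -> A \subset X -> u \in X -> v \in X -> u != v ->
  path_through w' A u v = path_through w (P :|: A) u v.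
Proof.
move=> w'E /subsetP sAX Xu Xv neq_uv.
apply/(path_throughP _ _ neq_uv)/(path_throughP _ _ neq_uv) => -[p wp Ap].
  elim: p u Xu {neq_uv} wp Ap => [|x p IHp] u Xu /=.
    rewrite andbT => w'uv _; have [_ _ neq_uv] := adj_in w'uv.
    move: w'uv; rewrite w'E // => /(path_throughP _ _ neq_uv)[q wq Pq].
    by exists q => //; apply/allP=> y /(allP Pq) Py; rewrite inE Py.
  case/andP=> w'ux w'p /andP[Ax Ap]; have Xx := sAX _ Ax.
  have [_ _ neq_ux] := adj_in w'ux.
  move: w'ux; rewrite w'E // => /(path_throughP _ _ neq_ux)[q wq Pq].
  have [r wr PAr] := IHp x Xx w'p Ap; exists (rcons q x ++ r).
    by rewrite rcons_cat cat_path wq last_rcons.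
  rewrite all_cat all_rcons PAr inE Ax orbT !andbT.
  by apply/allP=> y /(allP Pq) Py; rewrite inE Py.
(* [q] is the part of the walk through [P] read since the last cut, at [x]. *)
suff split_path q x : x \in X -> path (adj w) x (q ++ rcons p v) -> all [in P] q ->
    x = v \/ exists2 r, path (adj w') x (rcons r v) & all [in A] r.
  by have [] := split_path [::] u Xu wp isT => // def_u; rewrite def_u eqxx in neq_uv.
elim: p q x {wp} Ap => [|y p IHp] q x /=.
  move=> _ Xx wq Pq; have [-> | neq_xv] := eqVneq x v; [by left | right].
  exists [::] => //; rewrite /= andbT w'E //.
  by apply/(path_throughP _ _ neq_xv); exists q; rewrite // -cats1.
case/andP=> + PAp Xx; rewrite inE.
have [Py _ | nPy /= Ay] := boolP (y \in P).
  rewrite -cat_rcons => wqp Pq; apply: (IHp (rcons q y)) => //.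
  by rewrite all_rcons Py.
have Xy := sAX y Ay; rewrite -cat_rcons cat_path last_rcons => /andP[wq wp] Pq.
have [<- | neq_xy] := eqVneq y x; first exact: (IHp [::]).
have w'xy : adj w' x y.
  by rewrite w'E // 1?eq_sym //; apply/path_throughP; [rewrite eq_sym|exists q].
right; have [def_y | [r w'r Ar]] := IHp [::] y PAp Xy wp isT.
  by exists [::]; rewrite //= -def_y w'xy.
by exists (y :: r); rewrite /= ?w'xy ?Ay.
Qed.

Lemma edges_dunion (S T : {set V}) (w1 : sgraph S) (w2 : sgraph T) :
  edges (dunion w1 w2) = edges w1 :|: edges w2.
Proof.
apply: (@edge_set_eq _ (S :|: T)); first exact: edge_setP.
  by apply: edge_setU; apply: edge_set_sub (edge_setP _); rewrite ?subsetUl ?subsetUr.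
move=> u v neq_uv; rewrite [RHS]in_setU [LHS]in_edges_of neq_uv andTb.
rewrite -[X in _ = X || _]/(adj w1 u v) -[X in _ = _ || X]/(adj w2 u v).
rewrite -[X in [&& _, _ & X]]
  /((adj w1 u v || adj w2 u v) || (adj w1 v u || adj w2 v u)).
rewrite (adj_sym w1 v) (adj_sym w2 v) orbb; apply/and3P/idP => [[]//|w12].
split=> //; case/orP: w12 => /adj_in[? ? _]; rewrite inE; apply/orP; by [left|right].
Qed.

Lemma iprod_icoprod_basis s P (w' : sgraph (cupseq s)) :
    agrees_with_rip P w' ->
  exists (g : graphs s) (h : sgraph (cupseq s)),
    [/\ icoprodW (basis_vec K w') = basis_vec K g,
        iprodW (basis_vec K g) = basis_vec K h
      & edges h = composition_edges w P s].
Proof.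
have edges_agree X Q (w1 : sgraph X) A :
      agrees_with_rip Q w1 -> A \subset X ->
    edges_of A (adj w1) = edges_of A (path_through w Q).
  move=> w1E /subsetP sAX; apply: edges_of_eq => u v /sAX Xu /sAX Xv neq_uv.
  by rewrite !w1E // eq_sym.
elim: s P w' => [|A [|B s] IHs] P w' w'E.
- exists tt, (empty_graph V); split; rewrite /= ?lin_ext_basis //.
  by apply/setP=> e; rewrite !inE; apply/existsP=> -[u]; rewrite inE.
- exists w', w'; split=> //=; rewrite setU0 -(edges_agree _ _ _ _ w'E) //.
  by rewrite edges_of_adj.
set T := cupseq (B :: s) in w' w'E *.
have [|g [h [icopg iph def_h]]] := IHs (P :|: A) (rip A T w').
  move=> u v Tu Tv neq_uv; rewrite adj_mk Tu Tv neq_uv /=.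
  rewrite (@path_through_sym _ _ w' A v) 1?eq_sym // orbb.
  by rewrite (path_through_rip w'E) ?subsetUl // inE ?Tu ?Tv orbT.
exists (restr A w', g), (dunion (restr A w') h); split.
- rewrite [LHS]/= /coprodW lin_ext_basis tensor_basis.
  exact: tensor_map_basis.
- rewrite [LHS]/= (@tensor_map_basis _ _ _ _ _ _ _ _ _ (restr A w') h) //.
  by rewrite /prodW lin_ext_basis.
rewrite edges_dunion def_h [RHS]/=; congr (_ :|: _).
exact: edges_agree w'E (subsetUl _ _).
Qed.

End IteratedCoproduct.

Lemma antipode_term (K : fieldType) (V : finType) (I : {set V}) (w : sgraph I)
    (s : seq {set V}) (def_I : cupseq s = I) :
  exists2 h : sgraph I,
    castW def_I (iprodW (icoprodW (castW (esym def_I) (basis_vec K w))))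
      = basis_vec K h
    & edges h = composition_edges w set0 s.
Proof.
case: I / def_I w => w /=.
have [|g [h [icopg iph def_h]]] := @iprod_icoprod_basis K _ _ w s set0 w.
  by move=> u v _ _ neq_uv; rewrite path_through0.
by exists h; rewrite //= icopg.
Qed.

(** * The antipode formula *)

Section Antipode.

Variables (K : fieldType) (V : finType) (I : {set V}) (w : sgraph I).

(** The basis vector of the graph with edge set [E]; the value 0 when [E] is not
    the edge set of a graph on [I] is never met. *)
Definition edge_basis_vec (E : {set {set V}}) : {ffun sgraph I -> K^o} :=
  if insub E is Some g then basis_vec K g else 0.

Lemma edge_basis_vecE (g : sgraph I) : edge_basis_vec (edges g) = basis_vec K g.
Proof. by rewrite /edge_basis_vec valK. Qed.

Lemma antipode_tubing_sum :
  antipode (basis_vec K w) = tubing_sum w I edge_basis_vec.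
Proof.
rewrite -(alternating_composition_sum _ edge_basis_vec (ltnSn #|I|) (subxx I)).
rewrite big_ord_recl /= composition_sum0 expr0 scale1r /antipode.
have [I0 | nzI] := eqVneq I set0.
  rewrite big1 => [|k _].
    rewrite addr0 -edge_basis_vecE; congr edge_basis_vec.
    apply: (@edge_set_eq _ I); first exact: edge_setP.
      by apply/forall_inP=> e; rewrite inE.
    move=> u v _; rewrite [RHS]inE; apply/negP=> /(@adj_in _ _ w)[].
    by rewrite I0 inE.
  by have := ltn_ord k; rewrite {2}I0 cards0.
rewrite add0r -(big_mkord xpredT
  (fun k => (-1) ^+ k.+1 *: composition_sum w k.+1 I edge_basis_vec)).
rewrite big_add1 /=.
apply: eq_bigr => k _; rewrite /composition_sum scaler_sumr.
rewrite [RHS](reindex_omap (val : composition I k.+1 -> _) insub); last first.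
  by move=> c comp_c; rewrite insubT.
apply: eq_big => [[c comp_c]|c _] /=.
  by rewrite comp_c insubT eqxx.
have [h -> def_h] := antipode_term K w (cupseq_composition c).
by rewrite -def_h edge_basis_vecE.
Qed.

End Antipode.

(** * Connected components of the graph of a tubing *)

Section TubingGraphComponents.

Variables (V : finType) (I : {set V}) (w : sgraph I) (t : {set {set V}}).
Hypothesis tubing_t : tubing w t.
Implicit Types J : {set V}.

(* The vertices of the factor of w(t) contributed by [J]. *)
Let core J := J :\: below t J.

Let tubing_restr_t : tubing (restr I w) t.
Proof. by rewrite restr_self. Qed.

Lemma tubing_sub J : J \in t -> J \subset I.
Proof.
by have [tubes _ _ _] := tubingP w t (subxx I) tubing_restr_t; case/tubes.
Qed.

(** Otherwise [J] would be covered by tubes strictly inside it, and be one of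
    them by [cover_in]. *)
Lemma core_neq0 J : J \in t -> core J != set0.
Proof.
have [tubes lam free _] := tubingP w t (subxx I) tubing_restr_t.
move=> tJ; rewrite setD_eq0; apply/negP=> sJb.
pose D := [set A in t | A \proper J].
have def_J : cover D = J.
  apply/eqP; rewrite eqEsubset; apply/andP; split.
    by apply/bigcupsP=> A; rewrite inE => /andP[_ /proper_sub].
  by apply: subset_trans sJb _; apply/bigcupsP=> A tA; apply: bigcup_sup; rewrite inE.
have sDt : D \subset t by apply/subsetP=> A; rewrite inE => /andP[].
have [tubeJ _] := tubes J tJ.
have := cover_in lam free sDt.
by rewrite def_J inE properE subxx andbF => /(_ tubeJ).
Qed.

Lemma core_inj J1 J2 x :
  J1 \in t -> J2 \in t -> x \in core J1 -> x \in core J2 -> J1 = J2.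
Proof.
have [_ lam _ _] := tubingP w t (subxx I) tubing_restr_t.
move=> tJ1 tJ2 /setDP[J1x b1x] /setDP[J2x b2x].
apply/eqP; rewrite eqEsubset; have /or3P[disj | s12 | s21] := lam J1 J2 tJ1 tJ2.
- by move: (disjointFr disj J1x); rewrite J2x.
- rewrite s12; apply: contraR b2x => ns21; apply/bigcupP; exists J1 => //.
  by rewrite tJ1 properE s12.
rewrite s21 andbT; apply: contraR b1x => ns12; apply/bigcupP; exists J2 => //.
by rewrite tJ2 properE s21.
Qed.

(** Take the smallest tube containing [x]. *)
Lemma core_exists x : x \in I -> exists2 J, J \in t & x \in core J.
Proof.
move=> Ix; pose P J := (J \in t) && (x \in J).
have Pcover : exists J, P J.
  move: Ix; rewrite -(cover_tubing (subxx I) tubing_restr_t) => /bigcupP[J tJ Jx].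
  by exists J; apply/andP.
have [J0 PJ0] := Pcover.
have [J /minsetP[/andP[tJ Jx] minJ] _] := minset_exists PJ0.
exists J => //; rewrite inE Jx andbT; apply/bigcupP=> -[A /andP[tA properAJ] Ax].
have eqAJ : A \subset J -> A = J by apply: minJ; rewrite /P tA.
by have := properAJ; rewrite (eqAJ (proper_sub properAJ)) properE subxx.
Qed.

(** A path of [w] inside the tube [J] is cut at its vertices in the core; the
    pieces run through [below t J], hence are edges of the graph of the tubing. *)
Lemma connect_core J u v : J \in t -> u \in core J -> v \in core J ->
  connect (adj (tubing_graph w t)) u v.
Proof.
have [tubes _ _ _] := tubingP w t (subxx I) tubing_restr_t.
move=> tJ Ju Jv; have [/tubeP[_ _ connJ] _] := tubes J tJ.
have /connectP[p wp def_v] : connect (adj (restr J w)) u v.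
  by apply: connJ; [case/setDP: Ju | case/setDP: Jv].
move: wp; rewrite restr_path; last by case/setDP: Ju.
case/andP=> wp Jp; rewrite def_v in Jv *.
(* [q] is the part of the path through [below t J] read since the core vertex
   [x]. *)
have walk q x : x \in core J -> all [in below t J] q -> path (adj w) x (q ++ p) ->
    last x (q ++ p) \in core J ->
  connect (adj (tubing_graph w t)) x (last x (q ++ p)).
  elim: p Jp {wp u Ju v Jv def_v} q x => [|y p IHp] /=.
    move=> _ q x _ bq _; rewrite cats0; case/lastP: q => [|q y] in bq *; first by [].
    rewrite last_rcons; move: bq; rewrite all_rcons => /andP[by_ _].
    by rewrite inE by_.
  case/andP=> Jy Jp q x Jx bq; have [b_y | nby] := boolP (y \in below t J).
    by rewrite -cat_rcons; apply: IHp; rewrite ?all_rcons ?b_y.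
  rewrite -cat_rcons cat_path last_cat last_rcons => /andP[wq wp] Jlast.
  have Cy : y \in core J by rewrite inE nby.
  apply: connect_trans (IHp Jp [::] y Cy isT wp Jlast).
  have [<- // | neq_xy] := eqVneq x y; apply: connect1.
  apply/(adj_tubing_graph _ _ _ tubing_sub); split=> //; exists J => //.
  by split=> //; apply/(path_throughP _ _ neq_xy); exists q.
exact: (walk [::]).
Qed.

Lemma connect_in_core J u v : J \in t -> u \in core J ->
  connect (adj (tubing_graph w t)) u v -> v \in core J.
Proof.
move=> tJ + /connectP[p wp ->] {v}; elim: p u wp => //= v p IHp u.
case/andP=> /(adj_tubing_graph _ _ _ tubing_sub)[_ [J' tJ' [J'u J'v _]]] wp Ju.
by apply: IHp wp _; rewrite (core_inj tJ tJ' Ju J'u).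
Qed.

Lemma card_components_tubing_graph : #|components (tubing_graph w t)| = #|t|.
Proof.
have -> : components (tubing_graph w t) = core @: t.
  have componentE J x : J \in t -> x \in core J ->
      [set y in I | connect (adj (tubing_graph w t)) x y] = core J.
    move=> tJ Jx; apply/setP=> y; rewrite !inE; apply/andP/idP => [[_ xy]|Jy].
      by have := connect_in_core tJ Jx xy; rewrite inE.
    split; last by apply: connect_core tJ Jx _; rewrite inE.
    by apply: (subsetP (tubing_sub tJ)); case/andP: Jy.
  apply/setP=> C; apply/imsetP/imsetP => [[x Ix ->] | [J tJ ->]].
    by have [J tJ Jx] := core_exists Ix; exists J; rewrite ?(componentE J).
  have /set0Pn[x Jx] := core_neq0 tJ; exists x; last by rewrite (componentE J).
  by apply: (subsetP (tubing_sub tJ)); case/setDP: Jx.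
apply: card_in_imset => J1 J2 tJ1 tJ2 eqJ.
have /set0Pn[x Jx] := core_neq0 tJ1.
by apply: (core_inj tJ1 tJ2 Jx); rewrite -eqJ.
Qed.

End TubingGraphComponents.

Theorem theorem23p6 (K : fieldType) (charK0 : [pchar K] =i pred0)
    (V : finType) (I : {set V}) (w : sgraph I) :
  antipode (basis_vec K w)
    = \sum_(t : {set {set V}} | tubing w t)
        ((-1) ^+ #|t| : int)%:~R *: (basis_vec K (tubing_graph w t) : W K I)
  /\ cancellation_free (tubing w) (fun t => (-1) ^+ #|t|) (tubing_graph w).
Proof.
split.
  rewrite antipode_tubing_sum /tubing_sum restr_self.
  by apply: eq_bigr => t _; rewrite edge_basis_vecE rmorphXn /= rmorphN1.
move=> t1 t2 tubing1 tubing2 _ eq_graph.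
rewrite -(card_components_tubing_graph tubing1).
rewrite -(card_components_tubing_graph tubing2) eq_graph.
by rewrite -expr2 sqrr_sign.
Qed.
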